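(* The Bell polynomials $B_n(q)=\sum_{k=0}^n S(n,k)q^k$, $n\ge 0$, where $S(n,k)$ denotes the Stirling number of the second kind, form a strongly $q$-log-convex sequence; that is, for all integers $n\ge m\ge 1$, the polynomial $B_{m-1}(q)B_{n+1}(q)-B_m(q)B_n(q)$ has only nonnegative coefficients.
   Context: The Stirling numbers of the second kind satisfy $S(0,0)=1$, $S(n,0)=0$ for $n\ge 1$, $S(n,k)=0$ for $k>n$, and $S(n,k)=kS(n-1,k)+S(n-1,k-1)$ for $n,k\ge 1$. For real polynomials, $f(q)\ge_q g(q)$ means that $f(q)-g(q)$ has only nonnegative coefficients. A sequence of real polynomials $\{f_n(q)\}_{n\ge 0}$ is strongly $q$-log-convex if $f_{m-1}(q)f_{n+1}(q)\ge_q f_m(q)f_n(q)$ for all $n\ge m\ge 1$. *)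

(* Defs.v *)
From mathcomp Require Import all_boot all_order all_algebra.
From mathcomp Require Import reals.

Set Implicit Arguments.
Unset Strict Implicit.
Unset Printing Implicit Defensive.

Import Order.TTheory GRing.Theory Num.Theory.
Local Open Scope ring_scope.

(* Stirling numbers of the second kind; the boundary value S(n, k) = 0 for
   k > n follows from the other clauses, see [stirling2_small]. *)
Fixpoint stirling2 (n k : nat) : nat :=
  match n, k with
  | 0, 0 => 1
  | 0, _.+1 => 0
  | _.+1, 0 => 0
  | n'.+1, k'.+1 => k'.+1 * stirling2 n' k'.+1 + stirling2 n' k'
  end%N.

Lemma stirling2_small n k : (n < k)%N -> stirling2 n k = 0%N.
Proof.
elim: n k => [|n IHn] [|k] //= lt_nk.
by rewrite !IHn ?muln0 // ltnW.
Qed.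

Definition qge (R : numDomainType) (f g : {poly R}) : Prop :=
  forall i : nat, 0 <= (f - g)`_i.

Definition strongly_q_log_convex (R : numDomainType) (f : nat -> {poly R}) :
  Prop :=
  forall n m : nat, (1 <= m)%N -> (m <= n)%N ->
    qge (f m.-1 * f n.+1) (f m * f n).

Definition bell_poly (R : numDomainType) (n : nat) : {poly R} :=
  \sum_(k < n.+1) (stirling2 n k)%:R *: 'X^k.

(* Main.v *)
Require Import Defs.
From mathcomp Require Import all_boot all_order all_algebra.
From mathcomp Require Import reals.
From mathcomp Require Import zify ring.

(** Since [B_(n+1) = q (B_n + B_n')], the polynomial
    [B_(m-1) B_(n+1) - B_m B_n] is [q (B_(m-1) B_n' - B_(m-1)' B_n)].  With
    [i = m - 1], pairing [k] with [p - k] shows that twice its coefficient of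
    [q^p] is the sum over [k] of
    [(p - 2 k) (S(i,k) S(n,p-k) - S(i,p-k) S(n,k))],
    whose terms are nonnegative because the array [S] is totally positive of
    order 2. *)

Import Order.TTheory GRing.Theory Num.Theory.
Local Open Scope ring_scope.

Lemma stirling2SS n k :
  stirling2 n.+1 k.+1 = (k.+1 * stirling2 n k.+1 + stirling2 n k)%N.
Proof. by []. Qed.

(** By induction on [n]: the recurrence splits each side into four products. Allowing any nested
    pair [u], [v], not only neighbours of one index, makes every comparison between these products
    an instance of the induction hypothesis. *)
Lemma stirling2_log_concave n x y u v :
  (x + y = u + v)%N -> (y <= u)%N -> (y <= v)%N ->
  (stirling2 n x * stirling2 n y <= stirling2 n u * stirling2 n v)%N.
Proof.
elim: n x y u v => [|n IHn] x y u v exy le_yu le_yv.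
  case: x exy => [|x] exy //.
  by have [-> [-> ->]] : (y = 0 /\ u = 0 /\ v = 0)%N by lia.
(* If [u] or [v] equals [y], the two sides coincide. Otherwise [y < u] and [y < v], the strictness
   that [H3] and [H4] need. *)
have [uy|ne_uy] := eqVneq u y.
  by have -> : x = v; [lia | rewrite uy mulnC].
have [vy|ne_vy] := eqVneq v y.
  by have -> : x = u; [lia | rewrite vy].
case: y exy le_yu le_yv ne_uy ne_vy => [|y] exy le_yu le_yv ne_uy ne_vy.
  by rewrite muln0.
case: x u v exy le_yu le_yv ne_uy ne_vy => [|x] [|u] [|v];
  move=> exy le_yu le_yv ne_uy ne_vy; try lia.
rewrite !stirling2SS.
(* As the sums agree, the two products differ by [(u - y) * (v - y)]. *)
have le_prod : (x.+1 * y.+1 <= u.+1 * v.+1)%N.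
  by clear -exy le_yu le_yv; nia.
have H11 := IHn x.+1 y.+1 u.+1 v.+1 ltac:(lia) ltac:(lia) ltac:(lia).
have H00 := IHn x y u v ltac:(lia) ltac:(lia) ltac:(lia).
have H1 := IHn x.+1 y u.+1 v ltac:(lia) ltac:(lia) ltac:(lia).
have H2 := IHn x.+1 y u v.+1 ltac:(lia) ltac:(lia) ltac:(lia).
have H3 := IHn x y.+1 u.+1 v ltac:(lia) ltac:(lia) ltac:(lia).
have H4 := IHn x y.+1 u v.+1 ltac:(lia) ltac:(lia) ltac:(lia).
have G11 := leq_mul le_prod H11.
(* Both mixed products on the left are at most both mixed products on the right,
   so weights with equal sums [x + y = u + v] can be compared through [N]. *)
set N := minn (stirling2 n u.+1 * stirling2 n v)
              (stirling2 n u * stirling2 n v.+1).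
have M1 : (x.+1 * (stirling2 n x.+1 * stirling2 n y) <= x.+1 * N)%N.
  by rewrite leq_mul2l leq_min H1 H2.
have M2 : (y.+1 * (stirling2 n x * stirling2 n y.+1) <= y.+1 * N)%N.
  by rewrite leq_mul2l leq_min H3 H4.
have N1 : (u.+1 * N <= u.+1 * (stirling2 n u.+1 * stirling2 n v))%N.
  by rewrite leq_mul2l geq_minl.
have N2 : (v.+1 * N <= v.+1 * (stirling2 n u * stirling2 n v.+1))%N.
  by rewrite leq_mul2l geq_minr.
have eN : (x.+1 * N + y.+1 * N = u.+1 * N + v.+1 * N)%N.
  by rewrite -!mulnDl exy.
move: N M1 M2 N1 N2 eN => N M1 M2 N1 N2 eN.
clear -H00 G11 M1 M2 N1 N2 eN; lia.
Qed.

(* The case [u = y] is total positivity of order 2; the induction on the second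
   row index needs the intermediate positions of [u] as well. *)
Lemma stirling2_row_compare i j x y u v :
  (i <= j)%N -> (x + y = u + v)%N -> (y <= u)%N -> (y <= v)%N ->
  (stirling2 i x * stirling2 j y <= stirling2 i u * stirling2 j v)%N.
Proof.
move=> le_ij; rewrite -(subnKC le_ij).
elim: (j - i)%N x y u v => [|d IHd] x y u v exy le_yu le_yv.
  by rewrite addn0; apply: stirling2_log_concave.
rewrite addnS; case: y exy le_yu le_yv => [|y] exy le_yu le_yv.
  by rewrite muln0.
case: v exy le_yv => [|v] exy le_yv //.
have H1 := IHd x y.+1 u v.+1 exy le_yu le_yv.
have H0 := IHd x y u v ltac:(lia) ltac:(lia) ltac:(lia).
(* Only the second factor is expanded, so the weights to compare are just [y.+1] and [v.+1]. *)
rewrite !stirling2SS (mulnDr (stirling2 i x)) (mulnDr (stirling2 i u)).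
apply: leq_add; last exact: H0.
by rewrite (mulnCA _ y.+1) (mulnCA _ v.+1); apply: leq_mul.
Qed.

Lemma coef_bell_poly (R : numDomainType) n k :
  (bell_poly R n)`_k = (stirling2 n k)%:R.
Proof.
rewrite /bell_poly -(poly_def n.+1 (fun k => (stirling2 n k)%:R)) coef_poly.
by case: ltnP => // lt_nk; rewrite stirling2_small.
Qed.

Lemma bell_polyS (R : numDomainType) n :
  bell_poly R n.+1 = 'X * (bell_poly R n + (bell_poly R n)^`()).
Proof.
apply/polyP => -[|k]; rewrite coefXM !coef_bell_poly //=.
by rewrite coefD coef_deriv !coef_bell_poly natrD natrM mulr_natl addrC.
Qed.

Lemma coef_mul_Xderiv (R : numDomainType) (f g : {poly R}) p :
  (f * ('X * g^`()) - 'X * f^`() * g)`_p =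
  \sum_(k < p.+1) ((p - k)%:R - k%:R) * (f`_k * g`_(p - k)).
Proof.
have coefXd (h : {poly R}) k : ('X * h^`())`_k = k%:R * h`_k.
  by rewrite coefXM; case: k => [|k]; rewrite ?mul0r //= coef_deriv mulr_natl.
rewrite coefB !coefM -sumrB; apply: eq_bigr => k _.
by rewrite !coefXd; ring.
Qed.

Theorem corollary3p1 (R : realType) : strongly_q_log_convex (bell_poly R).
Proof.
move=> n [//|i] _ lt_in p /=.
set f := bell_poly R i; set g := bell_poly R n.
have -> : f * bell_poly R n.+1 - bell_poly R i.+1 * g
    = f * ('X * g^`()) - 'X * f^`() * g by rewrite !bell_polyS -/f -/g; ring.
rewrite coef_mul_Xderiv.
set s := \sum_(k < _) _.
have s_rev : s = \sum_(k < p.+1) (k%:R - (p - k)%:R) * (f`_(p - k) * g`_k).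
  rewrite /s (reindex_inj rev_ord_inj) /=; apply: eq_bigr => k _.
  by rewrite subSS subKn // -ltnS.
suff : 0 <= s *+ 2 by rewrite pmulrn_lge0.
rewrite mulr2n {2}s_rev /s -big_split /=; apply: sumr_ge0 => k _.
have -> : ((p - k)%:R - k%:R) * (f`_k * g`_(p - k))
    + (k%:R - (p - k)%:R) * (f`_(p - k) * g`_k)
    = ((p - k)%:R - k%:R) * (f`_k * g`_(p - k) - f`_(p - k) * g`_k) by ring.
rewrite !coef_bell_poly -!natrM.
have le_in : (i <= n)%N by apply: ltnW.
(* Both factors change sign where [k] passes [p - k]; in each case [y] and [u] are the smaller of
   these two indices. *)
have [le_k|/ltnW le_k] := leqP k (p - k).
  by rewrite mulr_ge0 ?subr_ge0 ?ler_nat // stirling2_row_compare // addnC.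
by rewrite mulr_le0 ?subr_le0 ?ler_nat // stirling2_row_compare // addnC.
Qed.
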